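(* Let $M^3$ be a translation hypersurface of type 3 in the isotropic space $\mathbb{I}^4$, i.e. $M^3$ is parameterized by $r(u,v,w)=(u+v+w,\,f(u),\,g(v),\,h(w))$ with $f,g,h$ smooth real functions of one variable and $f'\neq0$, $g'\neq 0$, and suppose its isotropic mean curvature is a nonzero constant $H_0$. Then, for $\lambda,\mu,\xi\in\mathbb{R}$, one of the following occurs: (i) $f(u)=\lambda u$, $g(v)=\mu v$, $h(w)=\dfrac{3H_0(\lambda\mu)^2}{(\lambda\mu)^2+\lambda^2+\mu^2}\,w^2$, $\lambda\mu\neq0$; (ii) $f(u)=\lambda u$, $g(v)=\left(\frac{-2\mu}{3H_0}v\right)^{\frac12}$, $h(w)=\mu w$, $\lambda\mu\neq0$; (iii) $f(u)=\lambda u^{\frac12}$, $g(v)=\mu v^{\frac12}$, $h(w)=\xi w$, $\lambda\mu\xi\neq0$.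
   Context: The isotropic space $\mathbb{I}^4$ is $\mathbb{R}^4$ with affine coordinates $(x_1,\dots,x_4)$ and the degenerate metric $dx_1^2+dx_2^2+dx_3^2$. All hypersurfaces considered have non-isotropic tangent hyperplanes, i.e. tangent hyperplanes not parallel to the $x_4$-axis. For a parameterized hypersurface $r$, let $[g_{ij}]$ be the matrix of the first fundamental form induced by the degenerate metric and $h_{ij}=\det(r_u,r_v,r_w,r_{ij})/\sqrt{\det g_{ij}}$, with $r_{ij}$ the second partial derivatives of $r$. The isotropic mean curvature $H$ is defined by $3H=\mathrm{tr}([h_{ij}][g_{ij}]^{-1})$. For a type 3 hypersurface as in the claim (with the sign convention used here) $$3H=h'\left[\frac{f''}{(f')^3}+\frac{g''}{(g')^3}\right]+h''\left[1+\frac1{(f')^2}+\frac1{(g')^2}\right],$$ where a prime denotes the derivative with respect to the function's own variable. The roles of $f$ and $g$ in this formula are symmetric, and by convention only the situations depending on $f$ are discussed.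
   Formalization: The coefficient of w² in (i) is halved (the printed one is off by a factor 2); the forms hold up to parameter shifts and added constants, and up to swapping f and g in (ii); the root in (ii) may have either sign; in (iii) u^{1/2}, v^{1/2} may also mean √(−u), √(−v). *)

(* Defs.v *)
From HB Require Import structures.
From mathcomp Require Import all_boot all_order all_algebra.
From mathcomp Require Import all_classical all_reals all_analysis.

Set Implicit Arguments.
Unset Strict Implicit.
Unset Printing Implicit Defensive.

Import Order.TTheory GRing.Theory Num.Theory.
Import numFieldNormedType.Exports.

Local Open Scope classical_set_scope.
Local Open Scope ring_scope.

Section Defs.
Variable R : realType.

Definition open_interval (A : set R) : Prop :=
  [/\ A !=set0, open A & is_interval A].

Definition smooth_on (A : set R) (f : R -> R) : Prop :=
  forall (n : nat) (t : R), A t -> derivable (derive1n n f) t 1.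

Section IsotropicGeometry.
Variable r : 'rV[R]_3 -> 'rV[R]_4.

Definition partial (i : 'I_3) (F : 'rV[R]_3 -> 'rV[R]_4) (p : 'rV[R]_3) :
  'rV[R]_4 := 'D_(delta_mx 0 i) F p.

Definition iso_metric (x y : 'rV[R]_4) : R :=
  \sum_(k < 4 | (k < 3)%N) x 0 k * y 0 k.

Definition first_form (p : 'rV[R]_3) : 'M[R]_3 :=
  \matrix_(i, j) iso_metric (partial i r p) (partial j r p).

Definition tangent_det (p : 'rV[R]_3) (x : 'rV[R]_4) : R :=
  \det (col_mx (\matrix_(i < 3) partial i r p) x : 'M[R]_(3 + 1)).

(* The quotient det(r_u, r_v, r_w, r_ij) / sqrt(det g) depends, up to sign, on
   the orientation of the parameterization.  The sign factor normalizes it to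
   the orientation for which (r_u, r_v, r_w, e_4) is a positive basis; this is
   the convention giving, for type 3 hypersurfaces,
     3H = h'(f''/f'^3 + g''/g'^3) + h''(1 + 1/f'^2 + 1/g'^2)
   whatever the sign of f' g'. *)
Definition second_form (p : 'rV[R]_3) : 'M[R]_3 :=
  \matrix_(i, j)
    (Num.sg (tangent_det p (delta_mx 0 ord_max))
     * (tangent_det p (partial i (partial j r) p)
        / Num.sqrt (\det (first_form p)))).

Definition iso_mean_curvature (p : 'rV[R]_3) : R :=
  \tr (second_form p *m invmx (first_form p)) / 3.

End IsotropicGeometry.

Definition type3 (f g h : R -> R) (p : 'rV[R]_3) : 'rV[R]_4 :=
  \row_k [:: p 0 0 + p 0 1 + p 0 2; f (p 0 0); g (p 0 1); h (p 0 2)]`_k.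

(* Shifting a parameter of a type 3 hypersurface, or adding a constant to f, g
   or h, amounts to a translation of the ambient space; the normal forms below
   are understood up to these.  D is the domain on which phi is considered. *)
Definition is_translate_of (A : set R) (f : R -> R) (D : set R)
    (phi : R -> R) : Prop :=
  exists s c : R, forall t, A t -> D (t - s) /\ f t = phi (t - s) + c.

(* The coefficient c of w^2 is fixed by 2 c (1 + 1/lambda^2 + 1/mu^2) = 3 H0. *)
Definition normal_form_i (H0 : R) (I J K : set R) (f g h : R -> R)
    (lambda mu : R) : Prop :=
  [/\ lambda * mu != 0,
      is_translate_of I f setT (fun u => lambda * u),
      is_translate_of J g setT (fun v => mu * v) &
      is_translate_of K h setT (fun w =>
        3 * H0 * (lambda * mu) ^+ 2
        / (2 * ((lambda * mu) ^+ 2 + lambda ^+ 2 + mu ^+ 2)) * w ^+ 2)].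

(* e selects one of the two determinations of the square root; they are
   exchanged by the isometry reversing the coordinate that carries g. *)
Definition normal_form_ii (H0 : R) (I J K : set R) (f g h : R -> R)
    (lambda mu : R) : Prop :=
  [/\ lambda * mu != 0,
      is_translate_of I f setT (fun u => lambda * u),
      exists e : bool,
        is_translate_of J g [set v | 0 < - 2 * mu / (3 * H0) * v]
          (fun v => (-1) ^+ e * Num.sqrt (- 2 * mu / (3 * H0) * v)) &
      is_translate_of K h setT (fun w => mu * w)].

(* The signs a, b allow u^(1/2) and v^(1/2) to stand for sqrt(-u), sqrt(-v) on
   the negative half-line.  All sign combinations occur: for instance
   f = sqrt(-u), g = 2 sqrt(v), h = w has 3H = 2 - 1/2. *)
Definition normal_form_iii (I J K : set R) (f g h : R -> R)
    (lambda mu xi : R) : Prop :=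
  [/\ lambda * mu * xi != 0,
      exists a : bool,
        is_translate_of I f [set u | 0 < (-1) ^+ a * u]
          (fun u => lambda * Num.sqrt ((-1) ^+ a * u)),
      exists b : bool,
        is_translate_of J g [set v | 0 < (-1) ^+ b * v]
          (fun v => mu * Num.sqrt ((-1) ^+ b * v)) &
      is_translate_of K h setT (fun w => xi * w)].

End Defs.

(* Main.v *)
(* The curvature equation reads
     h'(w) (A(u) + B(v)) + h''(w) (1 + P(u) + Q(v)) = 3 H0,
   with P = 1/f'^2, A = f''/f'^3 = - P'/2, and likewise Q, B for g.  If h'' is
   not identically zero, the separated form of the equation forces P and Q to be
   constant, so f and g are affine and h is quadratic.  If h'' = 0, then A and B
   are constants: where such a constant is 0 the function is affine; otherwise
   1/f'^2 is affine in u and f is a square root. *)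
Require Import Defs.
From HB Require Import structures.
From mathcomp Require Import all_boot all_order all_algebra.
From mathcomp Require Import all_classical all_reals all_analysis.
From mathcomp Require Import ring lra.
Import Order.TTheory GRing.Theory Num.Theory.
Import numFieldNormedType.Exports.
Local Open Scope classical_set_scope.
Local Open Scope ring_scope.

(** * First and second partial derivatives of the parameterization *)

Section Derivatives.
Variable R : realType.
Set Implicit Arguments.
Unset Strict Implicit.

(** The differential is linear in the direction. Here [c] will be a coordinate, 0 or 1, of a basis
    vector, so the degenerate direction 0 must be allowed. *)
Lemma is_derive_dir (f : R -> R) (t c : R) :
  derivable f t 1 -> is_derive t c f (c * derive1 f t).
Proof.
move=> /derivable1_diffP df; apply: DeriveDef; first exact: diff_derivable.
rewrite deriveE // derive1E deriveE //.
by rewrite -[in LHS](mulr1 c) -[c * 1]/(c *: 1) linearZ.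
Qed.

(** Both sides have literally the same difference quotient, so no chain rule is involved. *)
Lemma is_derive_coord n (f : R -> R) (p v : 'rV[R]_n) (j : 'I_n) (d : R) :
  is_derive (p 0 j) (v 0 j) f d -> is_derive p v (fun x => f (x 0 j)) d.
Proof.
have E : (fun h : R => h^-1 *: ((f \o shift (p 0 j)) (h *: v 0 j) - f (p 0 j))) =
  (fun h : R => h^-1 *:
    (((fun x : 'rV[R]_n => f (x 0 j)) \o shift p) (h *: v) - f (p 0 j))).
  by apply/funext => h; rewrite /= /shift !mxE.
by case=> fd <-; apply: DeriveDef; rewrite /derivable /derive -?E.
Qed.

Lemma is_derive_rV m (V : normedModType R) (F : V -> 'rV[R]_m) (p v : V)
    (d : 'rV[R]_m) :
  (forall k, is_derive p v (fun x => F x 0 k) (d 0 k)) -> is_derive p v F d.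
Proof.
move=> H; have dF : derivable F p v.
  by apply/derivable_mxP => i k; rewrite (ord1 i); case: (H k).
apply: DeriveDef => //; rewrite derive_mx //; apply/rowP => k.
by rewrite mxE; case: (H k).
Qed.

Definition row4 (a b c d : R) : 'rV[R]_4 := \row_k [:: a; b; c; d]`_k.

Lemma row4E (a b c d : R) k : row4 a b c d 0 k = [:: a; b; c; d]`_k.
Proof. exact: mxE. Qed.

(** The first entry [F] is left general to cover both differentiations: it is [u + v + w] the first
    time and the constant 1 the second time. *)
Lemma is_derive_row4 (F : 'rV[R]_3 -> R) (f g h : R -> R) (p v : 'rV[R]_3)
    (dF df dg dh : R) :
  is_derive p v F dF -> is_derive (p 0 0) (v 0 0) f df ->
  is_derive (p 0 1) (v 0 1) g dg -> is_derive (p 0 2) (v 0 2) h dh ->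
  is_derive p v
    (fun q => row4 (F q) (f (q 0 0)) (g (q 0 1)) (h (q 0 2)))
    (row4 dF df dg dh).
Proof.
move=> HF Hf Hg Hh; apply: is_derive_rV => k; rewrite row4E.
under eq_fun do rewrite row4E.
case: k => [[|[|[|[|//]]]] ?] //=; exact: is_derive_coord.
Qed.

Lemma partial_type3 (f g h : R -> R) (p : 'rV[R]_3) (i : 'I_3) :
  derivable f (p 0 0) 1 -> derivable g (p 0 1) 1 -> derivable h (p 0 2) 1 ->
  partial i (type3 f g h) p =
  row4 1 ((i == 0)%:R * derive1 f (p 0 0)) ((i == 1)%:R * derive1 g (p 0 1))
    ((i == 2)%:R * derive1 h (p 0 2)).
Proof.
move=> df dg dh; set v : 'rV[R]_3 := delta_mx 0 i.
have vE j : v 0 j = (i == j)%:R by rewrite mxE eqxx eq_sym.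
have c0 j : is_derive p v (fun x => x 0 j) (v 0 j).
  exact: (@is_derive_coord _ id).
have s1 : v 0 0 + v 0 1 + v 0 2 = 1.
  by rewrite !vE; case: i {v vE c0} => [[|[|[|//]]] ?]; rewrite /= ?addr0 ?add0r.
rewrite /partial -!vE -s1.
have H := is_derive_row4 (is_deriveD (is_deriveD (c0 0) (c0 1)) (c0 2))
  (is_derive_dir (v 0 0) df) (is_derive_dir (v 0 1) dg)
  (is_derive_dir (v 0 2) dh).
by case: H.
Qed.

Lemma partial2_type3 (I J K : set R) (f g h : R -> R) (p : 'rV[R]_3)
    (i j : 'I_3) :
  open I -> open J -> open K ->
  smooth_on I f -> smooth_on J g -> smooth_on K h ->
  I (p 0 0) -> J (p 0 1) -> K (p 0 2) ->
  partial i (partial j (type3 f g h)) p =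
  row4 0 (((i == 0) && (j == 0))%:R * derive1n 2 f (p 0 0))
    (((i == 1) && (j == 1))%:R * derive1n 2 g (p 0 1))
    (((i == 2) && (j == 2))%:R * derive1n 2 h (p 0 2)).
Proof.
move=> oI oJ oK sf sg sh Ip Jp Kp.
have nc (A : set R) (k : 'I_3) : open A -> A (p 0 k) -> \forall q \near p, A ((q : 'rV[R]_3) 0 k).
  by move=> oA Ap; apply: coord_continuous; exact: open_nbhs_nbhs.
(* The formula for the first partials is known only over the domain; openness makes it valid near
   [p], which suffices to differentiate it again. *)
have E : \forall q \near p, partial j (type3 f g h) q =
  row4 1 ((j == 0)%:R * derive1 f (q 0 0)) ((j == 1)%:R * derive1 g (q 0 1))
    ((j == 2)%:R * derive1 h (q 0 2)).
  have := nc I 0 oI Ip; have := nc J 1 oJ Jp; have := nc K 2 oK Kp.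
  apply: filterS3 => q Kq Jq Iq; rewrite partial_type3 //.
  - exact: (sf 0%N).
  - exact: (sg 0%N).
  - exact: (sh 0%N).
rewrite [LHS](near_eq_derive _ E); set v : 'rV[R]_3 := delta_mx 0 i.
have vE k : v 0 k = (i == k)%:R by rewrite mxE eqxx eq_sym.
have d2 (A : set R) (u : R -> R) (k : 'I_3) : smooth_on A u -> A (p 0 k) ->
  is_derive (p 0 k) (v 0 k) (fun t => (j == k)%:R * derive1 u t)
    (((i == k) && (j == k))%:R * derive1n 2 u (p 0 k)).
  move=> su Ap; have Hd := is_derive_dir (v 0 k) (su 1%N _ Ap).
  rewrite (_ : _ * _ = (j == k)%:R *: (v 0 k * derive1n 2 u (p 0 k))).
    exact: (is_deriveZ (j == k)%:R Hd).
  by rewrite vE /GRing.scale /= mulrA -natrM mulnb andbC.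
by case: (is_derive_row4 (is_derive_cst (1 : R) p v) (d2 _ _ _ sf Ip) (d2 _ _ _ sg Jp)
  (d2 _ _ _ sh Kp)).
Qed.

End Derivatives.

(** * Determinants, fundamental forms and the curvature formula *)

Section Curvature.
Variable R : realType.
Set Implicit Arguments.
Unset Strict Implicit.

Lemma det3 (A : 'M[R]_3) : \det A =
  A 0 0 * (A 1 1 * A 2 2 - A 1 2 * A 2 1)
  - A 0 1 * (A 1 0 * A 2 2 - A 1 2 * A 2 0)
  + A 0 2 * (A 1 0 * A 2 1 - A 1 1 * A 2 0).
Proof.
(* Indexing the entries by natural numbers lets the lifted ordinals of the cofactor expansion
   compute to literals. *)
pose a (i j : nat) := A (inord i) (inord j).
have E i j : A i j = a i j by rewrite /a !inord_val.
rewrite !(expand_det_row _ ord0) !big_ord_recl !big_ord0 /cofactor.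
rewrite !(expand_det_row _ ord0) !big_ord_recl !big_ord0 /cofactor.
rewrite !det_mx11 !mxE !E /= /bump /=.
rewrite ?expr0 ?expr1 ?exprS; ring.
Qed.

(** Used with [x] equal to [f' g']: the square root of the Gram determinant is its absolute value,
    and the orientation sign in [second_form] restores [f' g'] itself. *)
Lemma sgr_divr_norm (x y : R) : x != 0 -> Num.sg x * (y / `|x|) = y / x.
Proof.
case: (ltrgt0P x) => // x0 _.
  by rewrite gtr0_sg // mul1r.
by rewrite ltr0_sg // invrN mulrN mulN1r opprK.
Qed.

Lemma det4 (A : 'M[R]_4) : \det A =
  \sum_(j < 4) (-1) ^+ j * A 0 j *
    \det (\matrix_(k < 3, l < 3) A (lift 0 k) (lift j l)).
Proof.
rewrite (expand_det_row _ 0); apply: eq_bigr => j _.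
rewrite /cofactor add0n mulrCA mulrA; congr (_ * \det _).
by apply/matrixP => k l; rewrite !mxE.
Qed.

(** Keeping [x] general serves twice: the last basis vector gives [a * b], hence the orientation
    sign, and the second partials give the entries of the second form. *)
Lemma tangent_det_type3 (r : 'rV[R]_3 -> 'rV[R]_4) (p : 'rV[R]_3)
    (a b c : R) (x : 'rV[R]_4) :
  (forall i, partial i r p =
    row4 1 ((i == 0)%:R * a) ((i == 1)%:R * b) ((i == 2)%:R * c)) ->
  tangent_det r p x =
  a * b * x 0 3 - a * b * c * x 0 0 + b * c * x 0 1 + a * c * x 0 2.
Proof.
move=> dr; rewrite /tangent_det.
set A := (X in \det X).
pose e (i j : nat) : R := if (i < 3)%N then
  [:: 1; (i == 0)%:R * a; (i == 1)%:R * b; (i == 2)%:R * c]`_j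
  else x 0 (inord j).
have -> : A = \matrix_(i < 4, j < 4) e i j.
  apply/matrixP => i j; rewrite /A mxE [RHS]mxE /e; case: splitP => k ik.
    by rewrite mxE dr row4E ik ltn_ord.
  by rewrite ik (ord1 k) /= inord_val.
rewrite det4 !big_ord_recl big_ord0 !det3 !mxE /= /bump /= /e /=.
have -> : x 0 (inord 0) = x 0 0 by congr (x 0 _); apply/val_inj; rewrite /= inordK.
have -> : x 0 (inord 1) = x 0 1 by congr (x 0 _); apply/val_inj; rewrite /= inordK.
have -> : x 0 (inord 2) = x 0 2 by congr (x 0 _); apply/val_inj; rewrite /= inordK.
have -> : x 0 (inord 3) = x 0 3 by congr (x 0 _); apply/val_inj; rewrite /= inordK.
ring.
Qed.

Definition mx3 (s : seq (seq R)) : 'M[R]_3 :=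
  \matrix_(i, j) nth 0 (nth [::] s i) j.

(** The metric ignores the isotropic coordinate, so [c] drops out. *)
Lemma first_form_type3 (r : 'rV[R]_3 -> 'rV[R]_4) (p : 'rV[R]_3) (a b c : R) :
  (forall i, partial i r p =
    row4 1 ((i == 0)%:R * a) ((i == 1)%:R * b) ((i == 2)%:R * c)) ->
  first_form r p =
  mx3 [:: [:: 1 + a ^+ 2; 1; 1]; [:: 1; 1 + b ^+ 2; 1]; [:: 1; 1; 1]].
Proof.
move=> dr; apply/matrixP => i j; rewrite !mxE /iso_metric big_mkcond.
rewrite !big_ord_recl big_ord0 !dr !row4E /=.
by case: i => [[|[|[|//]]] ?]; case: j => [[|[|[|//]]] ?] /=; ring.
Qed.

(** Once the partials at [p] are given as data, this is matrix algebra: the second form is diagonal,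
    so the trace only meets the diagonal of the inverse first form. *)
Lemma iso_mean_curvature_type3 (r : 'rV[R]_3 -> 'rV[R]_4) (p : 'rV[R]_3)
    (a b c a2 b2 c2 : R) :
  a != 0 -> b != 0 ->
  (forall i, partial i r p =
    row4 1 ((i == 0)%:R * a) ((i == 1)%:R * b) ((i == 2)%:R * c)) ->
  (forall i j, partial i (partial j r) p =
    row4 0 (((i == 0) && (j == 0))%:R * a2) (((i == 1) && (j == 1))%:R * b2)
      (((i == 2) && (j == 2))%:R * c2)) ->
  3 * iso_mean_curvature r p =
  c * (a2 / a ^+ 3 + b2 / b ^+ 3) + c2 * (1 + a ^- 2 + b ^- 2).
Proof.
move=> a0 b0 dr ddr; have ff := first_form_type3 dr.
have dG : \det (first_form r p) = (a * b) ^+ 2.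
  by rewrite ff det3 !mxE /=; ring.
(* Explicit inverse of the first form, certified by multiplication. *)
set N := mx3 [:: [:: a ^- 2; 0; - a ^- 2]; [:: 0; b ^- 2; - b ^- 2];
  [:: - a ^- 2; - b ^- 2; 1 + a ^- 2 + b ^- 2]].
have NG : N *m first_form r p = 1%:M.
  rewrite ff; apply/matrixP => i j; rewrite !mxE !big_ord_recl big_ord0 !mxE /=.
  by case: i => [[|[|[|//]]] ?]; case: j => [[|[|[|//]]] ?]  /=; field; rewrite ?a0 ?b0.
have invG : invmx (first_form r p) = N.
  have [_ uG] := mulmx1_unit NG.
  by rewrite -[N](mulmxK uG) NG mul1mx.
have S : second_form r p =
    mx3 [:: [:: c * a2 / a; 0; 0]; [:: 0; c * b2 / b; 0]; [:: 0; 0; c2]].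
  apply/matrixP => i j; rewrite !mxE !(tangent_det_type3 _ dr) dG sqrtr_sqr ddr.
  rewrite !row4E !mxE /= !mulr1 !mulr0 subr0 !addr0 sgr_divr_norm ?mulf_neq0 //.
  by case: i => [[|[|[|//]]] ?]; case: j => [[|[|[|//]]] ?] /=; field;
    rewrite ?a0 ?b0.
rewrite /iso_mean_curvature invG S mulrCA divff ?mulr1 ?pnatr_eq0 //.
rewrite /mxtrace !big_ord_recl big_ord0 !mxE !big_ord_recl !big_ord0 !mxE /=.
by field; rewrite ?a0 ?b0.
Qed.

End Curvature.

(** * One-variable differential equations on intervals *)

Section Intervals.
Variable R : realType.
Set Implicit Arguments.
Unset Strict Implicit.
Implicit Types (A : set R) (f F : R -> R).

Lemma is_derive0_cst A F : is_interval A ->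
  (forall t, A t -> is_derive t 1 F 0) ->
  forall x y, A x -> A y -> F x = F y.
Proof.
move=> iA dF x y; wlog xy : x y / x <= y.
  by move=> H; case: (leP x y) => [|/ltW] xy Ax Ay; [|symmetry]; apply: H.
move=> Ax Ay; have inA z : z \in `[x, y] -> A z.
  by rewrite in_itv; exact: iA.
have cF : {within `[x, y], continuous F}.
  by apply: derivable_within_continuous => z /inA /dF [].
have dxy z : z \in `]x, y[ -> is_derive z 1 F (cst 0 z).
  by move=> /subset_itv_oo_cc /inA /dF.
have [c _] := MVT_segment xy dxy cF.
by rewrite mul0r => /subr0_eq.
Qed.

Lemma derive1_cst_on A F : open A ->
  (forall x y, A x -> A y -> F x = F y) -> forall t, A t -> derive1 F t = 0.
Proof.
move=> oA cF t At; rewrite derive1E -(derive_cst (F t) t 1).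
apply: near_eq_derive; have := open_nbhs_nbhs (conj oA At).
by apply: filterS => x Ax; exact: cF.
Qed.

(** A change of sign would produce a zero by the intermediate value theorem. This fixes one
    determination of the square root over the whole interval. *)
Lemma constant_sign A F : is_interval A ->
  (forall t, A t -> derivable F t 1) -> (forall t, A t -> F t != 0) ->
  exists e : bool, forall t, A t -> 0 < (-1) ^+ e * F t.
Proof.
move=> iA dF F0.
have noneg x y : A x -> A y -> F x < 0 -> 0 < F y -> False.
  move=> Ax Ay Fx Fy.
  have [c cA Fc] : exists2 c, A c & F c = 0; last by have := F0 _ cA; rewrite Fc eqxx.
  have mm : Num.min (F x) (F y) <= 0 <= Num.max (F x) (F y).
    by rewrite ge_min le_max (ltW Fx) (ltW Fy) orbT.
  have cont a b : A a -> A b -> {within `[a, b], continuous F}.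
    move=> Aa Ab; apply: derivable_within_continuous => z.
    by rewrite in_itv => /(iA _ _ Aa Ab) /dF.
  case: (leP x y) => [|/ltW] xy.
    have [c] := IVT xy (cont _ _ Ax Ay) mm.
    by rewrite in_itv => /(iA _ _ Ax Ay) ? ?; exists c.
  rewrite minC maxC in mm; have [c] := IVT xy (cont _ _ Ay Ax) mm.
  by rewrite in_itv => /(iA _ _ Ay Ax) ? ?; exists c.
have [[x Ax Fx]|npos] := pselect (exists2 x, A x & 0 < F x).
  exists false => t At; rewrite mul1r lt0r F0 //= leNgt; apply/negP => Ft.
  exact: noneg At Ax Ft Fx.
exists true => t At; rewrite mulN1r oppr_gt0 lt_neqAle F0 //= leNgt.
by apply/negP => Ft; apply: npos; exists t.
Qed.

Lemma smooth_is_derive A f n t : smooth_on A f -> A t ->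
  is_derive t 1 (derive1n n f) (derive1n n.+1 f t).
Proof. by move=> sf At; apply: DeriveDef; [exact: sf|rewrite -derive1E]. Qed.

Lemma affine_of_derive1_cst A f k : is_interval A -> smooth_on A f ->
  A !=set0 -> (forall t, A t -> derive1 f t = k) ->
  exists c, forall t, A t -> f t = k * t + c.
Proof.
move=> iA sf [x Ax] dk; exists (f x - k * x) => t At.
suff /(_ t x At Ax) : forall a b, A a -> A b -> f a - k * a = f b - k * b by lra.
apply: is_derive0_cst => // y Ay.
have dfy := smooth_is_derive 0 sf Ay; rewrite /= dk // in dfy.
have := is_deriveB dfy (is_deriveZ k (is_derive_id y 1)).
by rewrite /GRing.scale /= mulr1 subrr.
Qed.

Lemma quadratic_of_derive2_cst A f k : is_interval A -> smooth_on A f ->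
  A !=set0 -> k != 0 -> (forall t, A t -> derive1n 2 f t = k) ->
  exists s c, forall t, A t -> f t = k / 2 * (t - s) ^+ 2 + c.
Proof.
move=> iA sf [x Ax] k0 dk.
have sdf : smooth_on A (derive1 f).
  by move=> n t At; have := sf n.+1 t At; rewrite /derive1n iterSr.
have [d dfE] := affine_of_derive1_cst iA sdf (ex_intro _ x Ax) dk.
pose G t := f t - (k / 2 * (t * t) + d * t).
have cG : forall a b, A a -> A b -> G a = G b.
  apply: is_derive0_cst => // y Ay.
  have dfy := smooth_is_derive 0 sf Ay; rewrite /= dfE // in dfy.
  have iy := is_derive_id y (1 : R).
  apply: (is_derive_eq (is_deriveB dfy (is_deriveD
    (is_deriveZ (k / 2) (is_deriveM iy iy)) (is_deriveZ d iy)))).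
  by rewrite /GRing.scale /=; field.
(* These witnesses complete the square in [k / 2 * t ^+ 2 + d * t]. *)
exists (- d / k), (G x - d ^+ 2 / (2 * k)) => t At.
by rewrite (cG x t) // /G; field.
Qed.

Lemma is_derive_inv_derive1 A f t : smooth_on A f -> A t -> derive1 f t != 0 ->
  is_derive t 1 (fun x => (derive1 f x)^-1)
    (- (derive1n 2 f t / derive1 f t ^+ 2)).
Proof.
move=> sf At f0; have := is_deriveV f0 (smooth_is_derive 1 sf At).
by rewrite /GRing.scale /= mulNr mulrC.
Qed.

Lemma is_derive_inv_sqr A f t : smooth_on A f -> A t -> derive1 f t != 0 ->
  is_derive t 1 (fun x => derive1 f x ^- 2)
    (- 2 * (derive1n 2 f t / derive1 f t ^+ 3)).
Proof.
move=> sf At f0; have d1 := is_derive_inv_derive1 sf At f0.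
rewrite (_ : (fun x => _) = (fun x => (derive1 f x)^-1) * (fun x => (derive1 f x)^-1)).
  by apply: (is_derive_eq (is_deriveM d1 d1)); rewrite /GRing.scale /=; field.
by apply/funext => x; rewrite -exprVn.
Qed.

Lemma affine_of_derive2_0 A f : open_interval A -> smooth_on A f ->
  (forall t, A t -> derive1n 2 f t = 0) ->
  exists l c, forall t, A t -> derive1 f t = l /\ f t = l * t + c.
Proof.
move=> [[x Ax] _ iA] sf d0; exists (derive1 f x).
have cf : forall t, A t -> derive1 f t = derive1 f x.
  move=> t At; apply: (is_derive0_cst iA) At Ax => y Ay.
  by have := smooth_is_derive 1 sf Ay; rewrite d0.
have [c fE] := affine_of_derive1_cst iA sf (ex_intro _ x Ax) cf.
by exists c => t At; split; [exact: cf|exact: fE].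
Qed.

(* [1/f'^2] is affine with slope [-2a], and [f + 1/(a f')] is constant. *)
Lemma sqrt_of_derive2 A f a : open_interval A -> smooth_on A f ->
  (forall t, A t -> derive1 f t != 0) -> a != 0 ->
  (forall t, A t -> derive1n 2 f t / derive1 f t ^+ 3 = a) ->
  exists s c, exists e : bool, forall t, A t ->
    0 < - 2 * a * (t - s) /\
    f t = (-1) ^+ e / a * Num.sqrt (- 2 * a * (t - s)) + c.
Proof.
move=> [[x Ax] _ iA] sf f0 a0 fa.
pose G t := derive1 f t ^- 2 - (- 2 * a) * t.
have cG : forall p q, A p -> A q -> G p = G q.
  apply: is_derive0_cst => // y Ay.
  have dP := is_derive_inv_sqr sf Ay (f0 _ Ay); rewrite fa // in dP.
  have := is_deriveB dP (is_deriveZ (- 2 * a) (is_derive_id y 1)).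
  by rewrite /GRing.scale /= mulr1 subrr.
pose H t := f t + a^-1 * (derive1 f t)^-1.
have cH : forall p q, A p -> A q -> H p = H q.
  apply: is_derive0_cst => // y Ay.
  apply: (is_derive_eq (is_deriveD (smooth_is_derive 0 sf Ay)
    (is_deriveZ a^-1 (is_derive_inv_derive1 sf Ay (f0 _ Ay))))).
  (* Replacing [a] by its expression puts [f''] in a denominator, so [f''] must be shown nonzero;
     this follows from [a != 0]. *)
  rewrite /GRing.scale /= -(fa y Ay).
  have := f0 y Ay; have : derive1n 2 f y != 0.
    by apply: contra_neq a0 => d0; rewrite -(fa y Ay) d0 mul0r.
  by move=> /= n1 n2; field; rewrite n1 n2.
have [||e Pe] := @constant_sign A (fun t => (derive1 f t)^-1) iA.
- by move=> t At; case: (is_derive_inv_derive1 sf At (f0 _ At)).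
- by move=> t At; rewrite invr_neq0 ?f0.
(* The shift is the zero of the affine function [1/f'^2]. Since [f = H x - 1/(a f')], the sign of
   the root is opposite to that of [1/f'], whence [~~ e]. *)
exists (G x / (2 * a)), (H x), (~~ e) => t At.
have PE : - 2 * a * (t - G x / (2 * a)) = ((derive1 f t)^-1) ^+ 2.
  by rewrite exprVn (cG x t) // /G; field; rewrite a0 f0.
rewrite PE sqrtr_sqr exprn_even_gt0 //= invr_neq0 ?f0 //; split => //.
rewrite (cH x t) // /H.
have := Pe t At; set q := (derive1 f t)^-1 => {Pe}.
case: e => /= q0.
  by rewrite ltr0_norm; [field|lra].
by rewrite gtr0_norm; [field|lra].
Qed.

End Intervals.

(** * Separation of variables in the curvature equation *)

Section Separation.
Variables (R : realType) (I J K : set R) (f g h : R -> R).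
Set Implicit Arguments.
Unset Strict Implicit.

Lemma type3_curvature_eq (H0 u v w : R) : open I -> open J -> open K ->
  smooth_on I f -> smooth_on J g -> smooth_on K h ->
  (forall u, I u -> derive1 f u != 0) -> (forall v, J v -> derive1 g v != 0) ->
  (forall p : 'rV[R]_3, I (p 0 0) -> J (p 0 1) -> K (p 0 2) ->
    iso_mean_curvature (type3 f g h) p = H0) ->
  I u -> J v -> K w ->
  derive1 h w * (derive1n 2 f u / derive1 f u ^+ 3
                 + derive1n 2 g v / derive1 g v ^+ 3)
  + derive1n 2 h w * (1 + derive1 f u ^- 2 + derive1 g v ^- 2) = 3 * H0.
Proof.
move=> oI oJ oK sf sg sh f0 g0 Hcst Iu Jv Kw.
have [p [p0 p1 p2]] : exists p : 'rV[R]_3, [/\ p 0 0 = u, p 0 1 = v & p 0 2 = w].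
  by exists (\row_k [:: u; v; w]`_k); split; rewrite mxE.
rewrite -(Hcst p) ?p0 ?p1 ?p2 //; symmetry.
apply: iso_mean_curvature_type3; [exact: f0|exact: g0| |] => i.
  have df : derivable f (p 0 0) 1 by rewrite p0; exact: (sf 0%N).
  have dg : derivable g (p 0 1) 1 by rewrite p1; exact: (sg 0%N).
  have dh : derivable h (p 0 2) 1 by rewrite p2; exact: (sh 0%N).
  by rewrite (partial_type3 i df dg dh) p0 p1 p2.
by move=> j; rewrite (@partial2_type3 R I J K) ?p0 ?p1 ?p2.
Qed.

(* If [(A, P)] took two values, subtracting would make [y] and [z]
   proportional, hence both constant. *)
Lemma separated_cst (A P B Q y z : R -> R) (c : R) : J !=set0 -> c != 0 ->
  (forall u v w, I u -> J v -> K w ->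
    y w * (A u + B v) + z w * (1 + P u + Q v) = c) ->
  ((forall a b, K a -> K b -> y a = y b) -> forall w, K w -> z w = 0) ->
  (exists2 w, K w & z w != 0) ->
  forall s t, I s -> I t -> A s = A t /\ P s = P t.
Proof.
move=> [v Jv] c0 E yz [w0 Kw0 z0] s t Is It.
have D w : K w -> y w * (A s - A t) + z w * (P s - P t) = 0.
  by move=> Kw; have := E s v w Is Jv Kw; have := E t v w It Jv Kw; lra.
(* If the values of [A] agree, [D] at [w0] forces those of [P] to agree. Otherwise a contradiction
   is sought. *)
have [/subr0_eq Ast|Ast] := eqVneq (A s - A t) 0.
  split=> //; have := D w0 Kw0; rewrite Ast subrr mulr0 add0r.
  by move/eqP; rewrite mulf_eq0 (negbTE z0) => /eqP /subr0_eq.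
set m := - (P s - P t) / (A s - A t).
have ym w : K w -> y w = z w * m.
  by move=> Kw; apply: (mulIf Ast); rewrite /m -mulrA divfK //; have := D w Kw; lra.
(* With [y = m z] substituted, the equation at [s] and [v] reads [z S = c], so [z = c / S] does not
   depend on [w]. *)
set S := m * (A s + B v) + (1 + P s + Q v).
have zS w : K w -> z w * S = c.
  by move=> Kw; rewrite -(E s v w Is Jv Kw) (ym w Kw) /S; ring.
have S0 : S != 0 by apply: contra_neq c0 => S0; rewrite -(zS w0 Kw0) S0 mulr0.
have zE w : K w -> z w = c / S by move=> Kw; rewrite -(zS w Kw) mulfK.
case/eqP: z0; apply: yz Kw0 => a b Ka Kb.
(* Then [y] is constant too, and [yz] gives [z w0 = 0], contrary to the choice of [w0]. *)
by rewrite (ym a Ka) (ym b Kb) zE // zE.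
Qed.

(** Separation with [y = h'] and [z = h''] makes [1/f'^2] constant; its derivative [-2 f''/f'^3]
    then vanishes. Leaving [B] and [Q] abstract allows reuse with [f] and [g] exchanged. *)
Lemma derive2_0_of_separated (B Q : R -> R) (c : R) : open K -> J !=set0 ->
  c != 0 -> open I -> smooth_on I f -> (forall u, I u -> derive1 f u != 0) ->
  (forall u v w, I u -> J v -> K w ->
    derive1 h w * (derive1n 2 f u / derive1 f u ^+ 3 + B v)
    + derive1n 2 h w * (1 + derive1 f u ^- 2 + Q v) = c) ->
  (exists2 w, K w & derive1n 2 h w != 0) ->
  forall u, I u -> derive1n 2 f u = 0.
Proof.
move=> oK J0 c0 oI sf f0 E h2 u Iu.
have := @derive1_cst_on R I (fun x => derive1 f x ^- 2) oI.
move=> /(_ _ u Iu) P0.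
have {}P0 : derive1 (fun x => derive1 f x ^- 2) u = 0.
  by apply: P0 => x y Ix Iy; case: (separated_cst J0 c0 E (derive1_cst_on oK) h2 Ix Iy).
have [_] := is_derive_inv_sqr sf Iu (f0 u Iu).
rewrite -derive1E P0 => /esym /eqP; rewrite mulf_eq0 oppr_eq0 pnatr_eq0 /=.
by rewrite mulf_eq0 invr_eq0 expf_eq0 /= (negbTE (f0 u Iu)) orbF => /eqP.
Qed.

End Separation.

(** * Rescaling solutions to the normal forms *)

Section NormalForms.
Variable R : realType.
Set Implicit Arguments.
Unset Strict Implicit.

Lemma translate_affine (A : set R) (f : R -> R) (l c : R) :
  (forall t, A t -> f t = l * t + c) ->
  is_translate_of A f setT (fun t => l * t).
Proof. by move=> fE; exists 0, c => t At; split=> //; rewrite subr0 fE. Qed.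

(** For form (iii): [2 * |a|] is extracted from the root into the amplitude [l], leaving under the
    root only the sign of [- a]. *)
Lemma translate_sqrt (A : set R) (f : R -> R) (a : R) : a != 0 ->
  (exists s c, exists e : bool, forall t, A t ->
    0 < - 2 * a * (t - s) /\
    f t = (-1) ^+ e / a * Num.sqrt (- 2 * a * (t - s)) + c) ->
  exists2 l : R, l != 0 & exists b : bool,
    is_translate_of A f [set u | 0 < (-1) ^+ b * u]
      (fun u => l * Num.sqrt ((-1) ^+ b * u)).
Proof.
move=> a0 [s [c [e fE]]].
have s0 : 0 < Num.sqrt (2 * `|a|) by rewrite sqrtr_gt0 mulr_gt0 ?normr_gt0.
exists ((-1) ^+ e / a * Num.sqrt (2 * `|a|)).
  by rewrite !mulf_eq0 !negb_or signr_eq0 invr_eq0 a0 gt_eqF.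
have E x : - 2 * a * x = 2 * `|a| * ((-1) ^+ (0 < a)%R * x).
  case: (ltrgt0P a) a0 => [? _|? _|//].
    by rewrite /= expr1; ring.
  by rewrite /= expr0; ring.
exists (0 < a), s, c => t At /=; have [] := fE t At.
have a2 : 0 < 2 * `|a| by rewrite mulr_gt0 ?normr_gt0.
rewrite E => + ->; rewrite (pmulr_rgt0 _ a2) => ?; split=> //.
by rewrite sqrtrM ?mulr_ge0 // mulrA.
Qed.

(** For form (ii) the amplitude must be 1 up to sign: writing [-2 a] as [a^2 (-2 / a)] extracts
    [|a|], which cancels [1 / a] up to the sign of [a], absorbed into [e]. *)
Lemma translate_unit_sqrt (A : set R) (f : R -> R) (a : R) : a != 0 ->
  (exists s c, exists e : bool, forall t, A t ->
    0 < - 2 * a * (t - s) /\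
    f t = (-1) ^+ e / a * Num.sqrt (- 2 * a * (t - s)) + c) ->
  exists e : bool,
    is_translate_of A f [set u | 0 < - 2 / a * u]
      (fun u => (-1) ^+ e * Num.sqrt (- 2 / a * u)).
Proof.
move=> a0 [s [c [e fE]]]; exists (e (+) (a < 0)), s, c => t At /=.
have E x : - 2 * a * x = a ^+ 2 * (- 2 / a * x) by field.
have [] := fE t At.
have a2 : 0 < a ^+ 2 by rewrite exprn_even_gt0.
rewrite E => + ->; rewrite (pmulr_rgt0 _ a2) => ?; split=> //.
rewrite sqrtrM ?sqr_ge0 // sqrtr_sqr signr_addb mulrA; congr (_ * _ + _).
case: (ltrgt0P a) (a0) => [? _|? _|//].
  by rewrite /= expr0; field.
by rewrite /= expr1; field.
Qed.

End NormalForms.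

Theorem theorem5p3 (R : realType) (I J K : set R) (f g h : R -> R) (H0 : R) :
  open_interval I -> open_interval J -> open_interval K ->
  smooth_on I f -> smooth_on J g -> smooth_on K h ->
  (forall u, I u -> derive1 f u != 0) ->
  (forall v, J v -> derive1 g v != 0) ->
  H0 != 0 ->
  (forall p : 'rV[R]_3, I (p 0 0) -> J (p 0 1) -> K (p 0 2) ->
    iso_mean_curvature (type3 f g h) p = H0) ->
  exists lambda mu xi : R,
    [\/ normal_form_i H0 I J K f g h lambda mu,
        normal_form_ii H0 I J K f g h lambda mu
          \/ normal_form_ii H0 J I K g f h lambda mu
      | normal_form_iii I J K f g h lambda mu xi].
Proof.
move=> oiI oiJ oiK sf sg sh f0 g0 H00 Hcst.
have [[u0 Iu0] oI iI] := oiI; have [[v0 Jv0] oJ iJ] := oiJ.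
have [[w0 Kw0] oK iK] := oiK.
have E u v w := @type3_curvature_eq R I J K f g h H0 u v w oI oJ oK sf sg sh f0 g0 Hcst.
have c0 : 3 * H0 != 0 by rewrite mulf_neq0 ?pnatr_eq0.
(* A single point with [h'' != 0] is enough to force [f'' = g'' = 0]. *)
have [h2|h2] := pselect (exists2 w, K w & derive1n 2 h w != 0).
  have f2 : forall u, I u -> derive1n 2 f u = 0.
    exact: (@derive2_0_of_separated R I J K f h
      (fun v => derive1n 2 g v / derive1 g v ^+ 3) (fun v => derive1 g v ^- 2)
      _ oK (ex_intro _ v0 Jv0) c0).
  have g2 : forall v, J v -> derive1n 2 g v = 0.
    apply: (@derive2_0_of_separated R J I K g h
      (fun u => derive1n 2 f u / derive1 f u ^+ 3) (fun u => derive1 f u ^- 2)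
      _ oK (ex_intro _ u0 Iu0) c0) => // v u w Jv Iu Kw.
    by rewrite addrAC (addrC (_ / _)) E.
  have [l [cf fE]] := affine_of_derive2_0 oiI sf f2.
  have [m [cg gE]] := affine_of_derive2_0 oiJ sg g2.
  have l0 : l != 0 by have := f0 _ Iu0; have [->] := fE _ Iu0.
  have m0 : m != 0 by have := g0 _ Jv0; have [->] := gE _ Jv0.
  have T0 : l ^+ 2 * m ^+ 2 + l ^+ 2 + m ^+ 2 != 0.
    have l2 : 0 < l ^+ 2 by rewrite exprn_even_gt0.
    have m2 : 0 < m ^+ 2 by rewrite exprn_even_gt0.
    by rewrite gt_eqF // addr_gt0 // addr_gt0 // mulr_gt0.
  have S0 : 1 + l ^- 2 + m ^- 2 != 0.
    rewrite (_ : _ + _ = (l ^+ 2 * m ^+ 2 + l ^+ 2 + m ^+ 2) / (l ^+ 2 * m ^+ 2)).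
      by rewrite !mulf_eq0 invr_eq0 mulf_eq0 !expf_eq0 /= !negb_or T0 l0 m0.
    by field; rewrite l0 m0.
  have k0 : 3 * H0 / (1 + l ^- 2 + m ^- 2) != 0 by rewrite mulf_neq0 ?invr_eq0.
  (* With [f'' = g'' = 0] only the [h''] term survives, with a constant factor. *)
  have hk : forall w, K w -> derive1n 2 h w = 3 * H0 / (1 + l ^- 2 + m ^- 2).
    move=> w Kw; have := E _ _ _ Iu0 Jv0 Kw; rewrite f2 // g2 //.
    have [-> _] := fE _ Iu0; have [-> _] := gE _ Jv0.
    by rewrite !mul0r addr0 mulr0 add0r => <-; rewrite mulfK.
  have [s [c hE]] := quadratic_of_derive2_cst iK sh (ex_intro _ w0 Kw0) k0 hk.
  exists l, m, 0; apply: Or31; split.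
  - by rewrite mulf_neq0.
  - by apply: (translate_affine (c := cf)) => t /fE [].
  - by apply: (translate_affine (c := cg)) => t /gE [].
  - exists s, c => t Kt; split=> //; rewrite hE //; congr (_ * _ + _).
    by field; rewrite exprMn T0 m0 l0.
have h20 w : K w -> derive1n 2 h w = 0.
  by move=> Kw; case: (eqVneq (derive1n 2 h w) 0) => // n; case: h2; exists w.
(* From here [h] is affine with slope [xi], and the equation reduces to
   [xi * (A u + B v) = 3 * H0]. *)
have [xi [ch hE]] := affine_of_derive2_0 oiK sh h20.
pose A u := derive1n 2 f u / derive1 f u ^+ 3.
pose B v := derive1n 2 g v / derive1 g v ^+ 3.
have AB u v : I u -> J v -> xi * (A u + B v) = 3 * H0.
  move=> Iu Jv; rewrite -(E u v w0 Iu Jv Kw0) h20 // mul0r addr0.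
  by have [-> _] := hE _ Kw0.
have xi0 : xi != 0.
  by apply: contra_neq c0 => x0; rewrite -(AB _ _ Iu0 Jv0) x0 mul0r.
have AB1 u v : I u -> J v -> A u + B v = 3 * H0 / xi.
  by move=> Iu Jv; rewrite -(AB u v Iu Jv) mulrAC mulfV ?mul1r.
(* A sum of functions of independent variables is constant, so freezing one variable shows each
   summand constant. *)
have Ac u : I u -> A u = A u0.
  by move=> Iu; apply: (@addIr _ (B v0)); rewrite !AB1.
have Bc v : J v -> B v = B v0.
  by move=> Jv; apply: (@addrI _ (A u0)); rewrite !AB1.
have ab := AB1 _ _ Iu0 Jv0.
have trh : is_translate_of K h setT (fun w => xi * w).
  by apply: (translate_affine (c := ch)) => t /hE [].
have d20 (L : set R) (F : R -> R) : (forall t, L t -> derive1 F t != 0) ->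
    (forall t, L t -> derive1n 2 F t / derive1 F t ^+ 3 = 0) ->
    forall t, L t -> derive1n 2 F t = 0.
  move=> F0 F2 t Lt; apply/eqP; have /eqP := F2 t Lt.
  by rewrite mulf_eq0 invr_eq0 expf_eq0 /= (negbTE (F0 t Lt)) orbF.
(* Matches the radicand of form (ii), whose [mu] is [xi], with [-2 / a] for [a = 3 * H0 / xi]. *)
have cE : - 2 * xi / (3 * H0) = - 2 / (3 * H0 / xi) by field; rewrite H00 xi0.
(* If [A] vanishes, [f] is affine and [B] carries the whole nonzero sum [3 * H0 / xi], so [g] is a
   root. *)
have [a0|a0] := eqVneq (A u0) 0.
  have [l [cf fE]] := affine_of_derive2_0 oiI sf
    (d20 _ _ f0 (fun t It => etrans (Ac t It) a0)).
  have l0 : l != 0 by have := f0 _ Iu0; have [->] := fE _ Iu0.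
  have b0 : B v0 = 3 * H0 / xi by rewrite -ab a0 add0r.
  have n0 : 3 * H0 / xi != 0 by rewrite mulf_neq0 ?invr_eq0.
  have := sqrt_of_derive2 oiJ sg g0 n0 (fun t Jt => etrans (Bc t Jt) b0).
  move=> /(translate_unit_sqrt n0) trg.
  exists l, xi, 0; apply: Or32; left; split=> //; first exact: mulf_neq0.
    by apply: (translate_affine (c := cf)) => t /fE [].
  by rewrite cE.
have trf := sqrt_of_derive2 oiI sf f0 a0 Ac.
(* The mirror case, giving form (ii) with [f] and [g] exchanged; when both constants are nonzero,
   both functions are roots and form (iii) results. *)
have [b0|b0] := eqVneq (B v0) 0.
  have [l [cg gE]] := affine_of_derive2_0 oiJ sg
    (d20 _ _ g0 (fun t Jt => etrans (Bc t Jt) b0)).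
  have l0 : l != 0 by have := g0 _ Jv0; have [->] := gE _ Jv0.
  exists l, xi, 0; apply: Or32; right; split=> //; first exact: mulf_neq0.
    by apply: (translate_affine (c := cg)) => t /gE [].
  by rewrite cE -ab b0 addr0; exact: translate_unit_sqrt.
have [l l0 trf'] := translate_sqrt a0 trf.
have [m m0 trg] := translate_sqrt b0 (sqrt_of_derive2 oiJ sg g0 b0 Bc).
by exists l, m, xi; apply: Or33; split=> //; rewrite !mulf_neq0.
Qed.
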